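(* For the clique-oblivious vertex equality problem based on the CEG-18 set (defined in the context), the optimal classical value of the figure of merit $$S^{(2)}=\frac{1}{126}\sum_{x=1}^{18}\left(p(0|x,x)+\sum_{y\in N_x}p(1|x,y)\right)$$ is $S^{(2)}_c=\dfrac{20}{21}$.
   Context: CEG-18 graph: vertices $\{1,\dots,18\}$; two distinct vertices are adjacent iff they both belong to one of the nine sets $\Omega_1=\{1,2,3,4\}$, $\Omega_2=\{4,5,6,7\}$, $\Omega_3=\{7,8,9,10\}$, $\Omega_4=\{10,11,12,13\}$, $\Omega_5=\{13,14,15,16\}$, $\Omega_6=\{16,17,18,1\}$, $\Omega_7=\{2,9,11,18\}$, $\Omega_8=\{3,5,12,14\}$, $\Omega_9=\{6,8,15,17\}$. Each vertex lies in exactly two of these sets and has exactly six neighbors. $N_x$ denotes the set of neighbors of $x$. (The vertices correspond to the 18 vectors in dimension 4 of Cabello, Estebaranz and García-Alcaine, and the sets $\Omega_w$ to its nine bases. The weights are $t(x,y)=c_x/N$ for $y\in N_x\cup\{x\}$ and $0$ otherwise, with $c_x=m_x/(|N_x|+1)=2/7$, where $m_x=2$ is the number of sets $\Omega_w$ containing $x$, and $N=\sum_w|\Omega_w|=36$.) Task: Alice receives $x$ and Bob receives $y$ from $\{1,\dots,18\}$; Alice sends a classical message to Bob, who outputs $z\in\{0,1\}$; the correct answer is $0$ if $y=x$ and $1$ if $y\in N_x$. Classical clique-oblivious strategy: an arbitrary positive integer $L$, conditional probabilities $p_e(\tau|x)$, $\tau\in\{1,\dots,L\}$, with $\sum_\tau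 p_e(\tau|x)=1$, and $p_d(z|y,\tau)$ with $p_d(0|y,\tau)+p_d(1|y,\tau)=1$, such that for each $\tau$ the quantity $\frac14\sum_{x\in\Omega_w}p_e(\tau|x)$ is the same for all $w\in\{1,\dots,9\}$. Observed probabilities: $p(z|x,y)=\sum_\tau p_e(\tau|x)p_d(z|y,\tau)$. $S^{(2)}_c$ is the supremum of $S^{(2)}$ over all $L$ and all such strategies. *)

(* Defs.v *)
From mathcomp Require Import all_boot all_order all_algebra.
From mathcomp Require Import classical_sets reals.

Set Implicit Arguments.
Unset Strict Implicit.
Unset Printing Implicit Defensive.

Import Order.TTheory GRing.Theory Num.Theory.

Local Open Scope ring_scope.

(* The vertex labelled k (1 <= k <= 18) is the ordinal of value k - 1;
   likewise the set labelled w (1 <= w <= 9) is indexed by w - 1. *)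
Definition vertex := 'I_18.

Definition Omega_labels : seq (seq nat) :=
  [:: [:: 1; 2; 3; 4]; [:: 4; 5; 6; 7]; [:: 7; 8; 9; 10];
      [:: 10; 11; 12; 13]; [:: 13; 14; 15; 16]; [:: 16; 17; 18; 1];
      [:: 2; 9; 11; 18]; [:: 3; 5; 12; 14]; [:: 6; 8; 15; 17]]%N.

Definition Omega (w : 'I_9) : {set vertex} :=
  [set x : vertex | x.+1 \in nth [::] Omega_labels w]%SET.

Definition adjacent : rel vertex :=
  fun x y => (x != y) && [exists w : 'I_9, (x \in Omega w) && (y \in Omega w)].

Definition nbr (x : vertex) : {set vertex} :=
  [set y : vertex | adjacent x y]%SET.

(* Bob's output z is a boolean: [false] is z = 0 and [true] is z = 1. *)
Record co_strategy (R : realType) := CoStrategy {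
  nmsg : nat;
  nmsg_gt0 : (0 < nmsg)%N;
  enc : 'I_nmsg -> vertex -> R;         (* enc tau x = p_e(tau | x) *)
  dec : bool -> vertex -> 'I_nmsg -> R; (* dec z y tau = p_d(z | y, tau) *)
  enc_ge0 : forall tau x, 0 <= enc tau x;
  enc_sum1 : forall x, \sum_tau enc tau x = 1;
  dec_ge0 : forall z y tau, 0 <= dec z y tau;
  dec_sum1 : forall y tau, dec false y tau + dec true y tau = 1;
  enc_oblivious : forall tau w w',
    4^-1 * (\sum_(x in Omega w) enc tau x) =
    4^-1 * (\sum_(x in Omega w') enc tau x)
}.

Arguments enc {R} c tau x.
Arguments dec {R} c z y tau.

(* obs s z x y = p(z | x, y) *)
Definition obs (R : realType) (s : co_strategy R) (z : bool) (x y : vertex) : R :=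
  \sum_(tau < nmsg s) enc s tau x * dec s z y tau.

Definition S2 (R : realType) (s : co_strategy R) : R :=
  126^-1 * \sum_(x : vertex)
    (obs s false x x + \sum_(y in nbr x) obs s true x y).

(* [sup] returns 0 on a set that is empty or unbounded above, so an equation
   between [S2c] and a nonzero number also says that the supremum exists. *)
Definition S2c (R : realType) : R := sup (range (@S2 R)).

(* Main.v *)
(** Fix a message tau and let [e x] be its encoding weight and [s] the common sum
    of [e] over the sets Omega_w.  As every vertex lies in exactly two of these
    sets, which share no other vertex, the weights on [nbr y] add up to
    2(s - e y), so tau contributes at most the sum over y of max(e y, 2(s - e y)).
    Let B be the set of y with 3 e y > 2 s.  It meets each Omega_w at most once,
    and by parity (nine sets, each vertex in two of them) it misses some Omega_v.
    The mass s of Omega_v then lies outside B while the total mass is 9s/2, so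
    the mass of B is at most min(#|B|, 7/2) s.  This bounds the contribution of tau
    by 30 s, and the values of s add up to 4: S2 <= 120/126.

    For equality, regard vertices as edges of the graph whose nodes are the nine
    sets.  It is the 3x3 rook graph, with six triangles (rows and columns).  Each
    triangle gives a message: weight 1/3 on its edges and 2/3 on the three edges
    that join the two parallel triangles. *)
Require Import Defs.
From mathcomp Require Import all_boot all_order all_algebra.
From mathcomp Require Import classical_sets reals.
From mathcomp Require Import ring lra zify.

Set Implicit Arguments.
Unset Strict Implicit.
Unset Printing Implicit Defensive.

Import Order.TTheory GRing.Theory Num.Theory.

Local Open Scope ring_scope.

(** * Incidences between vertices and sets, by computation *)

Lemma sum_ord_sumn n (f : nat -> nat) :
  (\sum_(i < n) f i = sumn [seq f i | i <- iota 0 n])%N.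
Proof. by rewrite sumnE big_map -(big_mkord xpredT f) /index_iota subn0. Qed.

(** With [sum_ord_sumn], this turns claims about ordinals into closed computations on lists of
    naturals. *)
Lemma forall_ord_all n (P : pred nat) :
  all P (iota 0 n) -> forall i : 'I_n, P i.
Proof. by move=> /allP h i; apply: h; rewrite mem_iota ltn_ord. Qed.

Lemma in_Omega (x : vertex) (w : 'I_9) :
  (x \in Omega w) = (x.+1 \in nth [::] Omega_labels w).
Proof. by rewrite inE. Qed.

Lemma Omega_incidence (x : vertex) : (\sum_(w < 9) (x \in Omega w) = 2)%N.
Proof.
under eq_bigr do rewrite in_Omega.
rewrite (sum_ord_sumn 9 (fun w => x.+1 \in nth [::] Omega_labels w)).
apply/eqP; move: x; apply: (@forall_ord_all 18 (fun x =>
  sumn [seq (x.+1 \in nth [::] Omega_labels w : nat) | w <- iota 0 9] == 2%N)).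
by vm_compute.
Qed.

Lemma Omega_common (x y : vertex) : x != y ->
  (\sum_(w < 9) ((x \in Omega w) && (y \in Omega w)) <= 1)%N.
Proof.
under eq_bigr do rewrite !in_Omega.
rewrite (sum_ord_sumn 9 (fun w => (x.+1 \in nth [::] Omega_labels w) &&
  (y.+1 \in nth [::] Omega_labels w))) -val_eqE; apply/implyP.
move: y; apply: (@forall_ord_all 18 (fun y => (val x != y) ==> (sumn
  [seq ((x.+1 \in nth [::] Omega_labels w) && (y.+1 \in nth [::] Omega_labels w)
    : nat) | w <- iota 0 9] <= 1)%N)).
move: x; apply: (@forall_ord_all 18 (fun x => all (fun y => (x != y) ==> (sumn
  [seq ((x.+1 \in nth [::] Omega_labels w) && (y.+1 \in nth [::] Omega_labels w)
    : nat) | w <- iota 0 9] <= 1)%N) (iota 0 18))).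
by vm_compute.
Qed.

(** Adjacency becomes a count of common sets, so a sum over neighbors can be exchanged with a sum
    over sets. *)
Lemma Omega_common_adjacent (x y : vertex) : x != y ->
  (\sum_(w < 9) ((x \in Omega w) && (y \in Omega w)) = adjacent x y)%N.
Proof.
move=> xy; have := Omega_common xy; rewrite /adjacent xy /=.
case: existsP => [[w hw]|no_w] le1.
  apply/eqP; rewrite eqn_leq le1 /=.
  by rewrite (bigD1 w) //= hw.
rewrite big1 // => w _; case hw: (_ && _) => //.
by case: no_w; exists w.
Qed.

Lemma adjacent_sym : symmetric adjacent.
Proof.
move=> x y; rewrite /adjacent eq_sym; congr (_ && _).
by apply: eq_existsb => w; rewrite andbC.
Qed.

(** * Upper bound on the contribution of one message *)

Section Weights.
Variable R : realType.
Implicit Types (e d : vertex -> R) (s : R).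

Lemma sum_Omega e : \sum_w \sum_(x in Omega w) e x = 2 * \sum_x e x.
Proof.
rewrite mulr_sumr; under eq_bigr do rewrite big_mkcond.
rewrite exchange_big; apply: eq_bigr => x _ /=.
transitivity ((\sum_(w < 9) (x \in Omega w))%N%:R * e x).
  rewrite natr_sum mulr_suml; apply: eq_bigr => w _.
  by case: (x \in Omega w); rewrite ?mul1r ?mul0r.
by rewrite Omega_incidence.
Qed.

Lemma sum_nbr e s y : (forall w, \sum_(x in Omega w) e x = s) ->
  \sum_(x in nbr y) e x = 2 * (s - e y).
Proof.
move=> es.
have -> : 2 * (s - e y) = \sum_w (y \in Omega w)%:R * (s - e y).
  by rewrite -mulr_suml -natr_sum Omega_incidence.
have -> : \sum_w (y \in Omega w)%:R * (s - e y) =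
    \sum_w \sum_(x | x != y) ((y \in Omega w) && (x \in Omega w))%:R * e x.
  apply: eq_bigr => w _; case: (boolP (y \in Omega w)) => yw; last first.
    by rewrite mul0r big1 // => x _; rewrite mul0r.
  rewrite mul1r -(es w) (bigD1 y) //= addrAC subrr add0r.
  rewrite [LHS]big_mkcond [RHS]big_mkcond; apply: eq_bigr => x _ /=.
  by case: (x \in Omega w); case: (x != y); rewrite ?mul1r ?mul0r.
rewrite exchange_big /= [LHS]big_mkcond [RHS]big_mkcond; apply: eq_bigr => x _.
rewrite inE; have [->|xy] /= := eqVneq x y; first by rewrite /adjacent eqxx.
rewrite -mulr_suml -natr_sum Omega_common_adjacent 1?eq_sym //.
by case: (adjacent y x); rewrite ?mul1r ?mul0r.
Qed.

Lemma heavy_mass_le e s (B : {set vertex}) : (forall x, 0 <= e x) ->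
    (forall w, \sum_(x in Omega w) e x = s) ->
    (forall y, y \in B -> 2 * s < 3 * e y) ->
  \sum_(y in B) e y <= 7 / 2 * s.
Proof.
move=> e0 es hB.
have s0 : 0 <= s by rewrite -(es ord0); apply: sumr_ge0.
have meet1 w : (\sum_(x in B) (x \in Omega w) <= 1)%N.
  rewrite leqNgt; apply/negP.
  rewrite -big_mkcondr /= sum1_card => /card_gt1P[x [y [/andP[xB xw] /andP[yB yw] xy]]].
  have := es w; rewrite (bigD1 x) //= (bigD1 y) /=; last by rewrite yw eq_sym.
  have : 0 <= \sum_(i | (i \in Omega w) && (i != x) && (i != y)) e i.
    by apply: sumr_ge0.
  (* Two elements of [B] in one set would weigh more than 4s/3 >= s. *)
  by have := hB _ xB; have := hB _ yB; lra.
have [v hv] : exists v, (\sum_(x in B) (x \in Omega v) = 0)%N.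
  apply/'exists_eqP; apply: contraT; rewrite negb_exists => /forallP h.
  have : (\sum_w \sum_(x in B) (x \in Omega w) = 9)%N.
    rewrite -[RHS]card_ord -sum1_card; apply: eq_bigr => w _.
    by have := meet1 w; have := h w; case: (\sum_(_ in _) _)%N => [|[]].
  rewrite exchange_big /=; under eq_bigr do rewrite Omega_incidence.
  by rewrite sum_nat_const; lia.
have disj x : x \in Omega v -> x \notin B.
  move=> xv; apply/negP => xB; move: hv.
  by rewrite (bigD1 x) //= xv.
have tot : 2 * \sum_x e x = 9 * s.
  rewrite -sum_Omega; under eq_bigr do rewrite es.
  by rewrite sumr_const card_ord mulr_natl.
have : \sum_(x in B) e x + s <= \sum_x e x.
  rewrite -(es v) [leRHS](bigID [in B]) /= lerD2l.
  rewrite [leRHS](bigID [in Omega v]) /=.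
  rewrite [X in _ <= X + _](eq_bigl [in Omega v]) ?lerDl ?sumr_ge0 // => x.
  by rewrite andb_idl // => /disj.
by lra.
Qed.

Lemma message_value_le e d s : (forall x, 0 <= e x) ->
    (forall w, \sum_(x in Omega w) e x = s) -> (forall x, 0 <= d x <= 1) ->
  \sum_y (d y * e y + (1 - d y) * (2 * (s - e y))) <= 30 * s.
Proof.
move=> e0 es d01.
have s0 : 0 <= s by rewrite -(es ord0); apply: sumr_ge0.
pose B : {set vertex} := [set y | 2 * s < 3 * e y]%SET.
have es_le y : e y <= s.
  have [w yw] : exists w, y \in Omega w.
    apply/existsP; apply: contraT; rewrite negb_exists => /forallP h.
    have := Omega_incidence y; rewrite big1 // => w _.
    by rewrite (negPf (h w)).
  by rewrite -(es w) (bigD1 y) //= lerDl sumr_ge0.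
have tot : 2 * \sum_x e x = 9 * s.
  rewrite -sum_Omega; under eq_bigr do rewrite es.
  by rewrite sumr_const card_ord mulr_natl.
have le_max : \sum_y (d y * e y + (1 - d y) * (2 * (s - e y))) <=
    \sum_y (2 * (s - e y) + (if y \in B then 3 * e y - 2 * s else 0)).
  apply: ler_sum => y _; have /andP[dy0 dy1] := d01 y.
  (* The term on the left is 2(s - e y) + d y (3 e y - 2 s), with [d y] between 0 and 1. *)
  rewrite inE; case: ltP => h; nra.
apply: le_trans le_max _.
rewrite big_split /= -big_mkcond /= -mulr_sumr !sumrB -mulr_sumr !sumr_const.
rewrite card_ord -[s *+ 18]mulr_natl -[_ *+ #|B|]mulr_natl.
have B72 : \sum_(y in B) e y <= 7 / 2 * s.
  by apply: heavy_mass_le => // y; rewrite inE.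
have Bcard : \sum_(y in B) e y <= #|B|%:R * s.
  rewrite mulr_natl -sumr_const; exact: ler_sum.
(* The terms 2(s - e y) sum to 36s - 9s = 27s, so [B] may add at most 3s. It adds at most #|B| s if
   #|B| <= 3, and at most 21/2 s - 8s otherwise. *)
have [b3|b4] := leqP #|B| 3.
  have : #|B|%:R <= 3 :> R by rewrite ler_nat.
  by nra.
have : 4 <= #|B|%:R :> R by rewrite ler_nat.
by nra.
Qed.

End Weights.

(** * The figure of merit as a sum over messages *)

Section Value.
Variable R : realType.

Definition msg_mass (st : co_strategy R) (tau : 'I_(nmsg st)) :=
  \sum_(x in Omega ord0) enc st tau x.

Lemma msg_massE (st : co_strategy R) (tau : 'I_(nmsg st)) w :
  \sum_(x in Omega w) enc st tau x = msg_mass tau.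
Proof. by have := enc_oblivious tau w ord0; rewrite /msg_mass; lra. Qed.

Lemma sum_msg_mass (st : co_strategy R) : \sum_(tau < nmsg st) msg_mass tau = 4.
Proof.
have Omega0 : #|Omega ord0| = 4%N.
  rewrite -sum1_card big_mkcond; under eq_bigr do rewrite in_Omega.
  by rewrite (sum_ord_sumn 18 (fun x => if x.+1 \in _ then 1%N else 0%N)).
rewrite exchange_big /=; under eq_bigr do rewrite enc_sum1.
by rewrite sumr_const Omega0.
Qed.

Lemma S2E (st : co_strategy R) :
  S2 st = 126^-1 * \sum_tau \sum_y (dec st false y tau * enc st tau y +
    (1 - dec st false y tau) * (2 * (msg_mass tau - enc st tau y))).
Proof.
rewrite /S2 big_split /=; congr (_ * _).
under [RHS]eq_bigr do rewrite big_split /=.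
rewrite big_split /=; congr (_ + _).
  rewrite exchange_big /=; apply: eq_bigr => tau _.
  by apply: eq_bigr => y _; rewrite mulrC.
(* Bob's input becomes the outer index; symmetry of adjacency then gives a sum over [nbr y]. *)
rewrite (exchange_big_dep xpredT) //= [RHS]exchange_big /=; apply: eq_bigr => y _.
rewrite /obs exchange_big /=; apply: eq_bigr => tau _.
rewrite -(sum_nbr y (msg_massE tau)) mulr_sumr.
rewrite (eq_bigl [in nbr y]); last by move=> x; rewrite !inE adjacent_sym.
by apply: eq_bigr => x _; rewrite -(dec_sum1 y tau); ring.
Qed.

Lemma S2_le (st : co_strategy R) : S2 st <= 20 / 21.
Proof.
have -> : 20 / 21 = 126^-1 * (30 * \sum_(tau < nmsg st) msg_mass tau) :> R.
  by rewrite sum_msg_mass; lra.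
rewrite S2E ler_wpM2l //; first by lra.
rewrite mulr_sumr; apply: ler_sum => tau _.
apply: message_value_le => [x|w|x]; [exact: enc_ge0|exact: msg_massE|].
have := dec_sum1 x tau.
have := dec_ge0 false x tau; have := dec_ge0 true x tau.
by lra.
Qed.

End Value.

(** * The six messages of the optimal strategy *)

Definition triangle_labels : seq (seq nat) :=
  [:: [:: 1; 2; 18]; [:: 12; 13; 14]; [:: 6; 7; 8];
      [:: 9; 10; 11]; [:: 3; 4; 5]; [:: 15; 16; 17]]%N.

Definition crossing_labels : seq (seq nat) :=
  [:: [:: 5; 10; 15]; [:: 4; 9; 17]; [:: 3; 11; 16];
      [:: 1; 6; 14]; [:: 8; 13; 18]; [:: 2; 7; 12]]%N.

Definition crossing (tau x : nat) : bool := x.+1 \in nth [::] crossing_labels tau.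

(** Three times the encoding probability, kept in [nat] for computation. *)
Definition weight (tau x : nat) : nat :=
  (x.+1 \in nth [::] triangle_labels tau) + 2 * crossing tau x.

(** Each edge lies in one triangle and is a crossing edge for one other: 1 + 2. *)
Lemma sum_weight (x : vertex) : (\sum_(tau < 6) weight tau x = 3)%N.
Proof.
rewrite (sum_ord_sumn 6 (weight^~ x)); apply/eqP; move: x.
apply: (@forall_ord_all 18 (fun x =>
  sumn [seq weight tau x | tau <- iota 0 6] == 3%N)).
by vm_compute.
Qed.

(** A node of the triangle is on two of its edges, any other node on one crossing edge. *)
Lemma sum_weight_Omega (tau : 'I_6) (w : 'I_9) :
  (\sum_(x in Omega w) weight tau x = 2)%N.
Proof.
rewrite big_mkcond; under eq_bigr do rewrite in_Omega.
rewrite (sum_ord_sumn 18 (fun x =>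
  if x.+1 \in nth [::] Omega_labels w then weight tau x else 0%N)).
apply/eqP; move: w; apply: (@forall_ord_all 9 (fun w => sumn
  [seq if x.+1 \in nth [::] Omega_labels w then weight tau x else 0%N
    | x <- iota 0 18] == 2%N)).
move: tau; apply: (@forall_ord_all 6 (fun tau => all (fun w => sumn
  [seq if x.+1 \in nth [::] Omega_labels w then weight tau x else 0%N
    | x <- iota 0 18] == 2%N) (iota 0 9))).
by vm_compute.
Qed.

(** Each message gives 3 * 2 on crossing edges, 3 * 2 on triangle edges and 12 * 4 elsewhere, 60 in
    all. *)
Lemma weight_value :
  (\sum_(tau < 6) \sum_(y < 18)
     (if crossing tau y then weight tau y else 2 * (2 - weight tau y)) = 360)%N.
Proof.
under eq_bigr => tau _ do rewrite (sum_ord_sumn 18 (fun y =>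
  if crossing tau y then weight tau y else (2 * (2 - weight tau y))%N)).
rewrite (sum_ord_sumn 6 (fun tau => sumn [seq
  if crossing tau y then weight tau y else (2 * (2 - weight tau y))%N
    | y <- iota 0 18])).
by vm_compute.
Qed.

(** Ensures that the subtraction [2 - weight tau y] in [nat] is not truncated. *)
Lemma weight_le2 (tau : 'I_6) (x : vertex) : (weight tau x <= 2)%N.
Proof.
move: x; apply: (@forall_ord_all 18 (fun x => weight tau x <= 2)%N).
move: tau; apply: (@forall_ord_all 6 (fun tau =>
  all (fun x => weight tau x <= 2)%N (iota 0 18))).
by vm_compute.
Qed.

(** * The strategy over the reals and its value *)

Section Optimal.
Variable R : realType.

Definition opt_enc (tau : 'I_6) (x : vertex) : R := (weight tau x)%:R / 3.

(** Bob answers 0 exactly on crossing edges; with s = 2/3 these are the y with 3 e y > 2 s. *)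
Definition opt_dec (z : bool) (y : vertex) (tau : 'I_6) : R :=
  (z (+) crossing tau y)%:R.

Lemma opt_enc_ge0 tau x : 0 <= opt_enc tau x.
Proof. by rewrite divr_ge0. Qed.

Lemma opt_enc_sum1 x : \sum_tau opt_enc tau x = 1.
Proof. by rewrite -mulr_suml -natr_sum sum_weight divff ?pnatr_eq0. Qed.

Lemma opt_dec_ge0 z y tau : 0 <= opt_dec z y tau.
Proof. exact: ler0n. Qed.

Lemma opt_dec_sum1 y tau : opt_dec false y tau + opt_dec true y tau = 1.
Proof. by rewrite /opt_dec; case: crossing; rewrite ?addr0 ?add0r. Qed.

Lemma opt_enc_Omega tau w : \sum_(x in Omega w) opt_enc tau x = 2 / 3.
Proof. by rewrite -mulr_suml -natr_sum sum_weight_Omega. Qed.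

Lemma opt_enc_oblivious tau w w' :
  4^-1 * (\sum_(x in Omega w) opt_enc tau x) =
  4^-1 * (\sum_(x in Omega w') opt_enc tau x).
Proof. by rewrite !opt_enc_Omega. Qed.

Definition opt_strategy : co_strategy R :=
  @CoStrategy R 6 isT opt_enc opt_dec opt_enc_ge0 opt_enc_sum1 opt_dec_ge0
    opt_dec_sum1 opt_enc_oblivious.

Lemma S2_opt : S2 opt_strategy = 20 / 21.
Proof.
have -> : 20 / 21 = 126^-1 * (360%:R / 3) :> R by lra.
rewrite S2E -weight_value natr_sum mulr_suml; congr (_ * _).
apply: eq_bigr => tau _; rewrite natr_sum mulr_suml; apply: eq_bigr => y _.
rewrite /msg_mass /= opt_enc_Omega /opt_dec /opt_enc /=.
case: crossing; first by rewrite /=; lra.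
by rewrite natrM natrB ?weight_le2 //=; lra.
Qed.

End Optimal.

Theorem proposition4 (R : realType) : S2c R = 20 / 21.
Proof.
have ub : ubound (range (@S2 R)) (20 / 21) by move=> _ [st _ <-]; exact: S2_le.
have opt : range (@S2 R) (20 / 21) by exists (opt_strategy R) => //; exact: S2_opt.
apply/eqP; rewrite eq_le; apply/andP; split.
  by apply: ge_sup => //; exists (20 / 21).
by apply: ub_le_sup => //; exists (20 / 21).
Qed.
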